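(* Let $x\in C[0,1]$ be nonconstant with Faber--Schauder coefficients $\theta_{m,k}$. (a) The following conditions are equivalent. (i) There exists $r_1\in(0,1)$ such that the weighted quadratic variation $2^{n(2r_1-1)}\langle x\rangle_n^{(2)}$ converges, as $n\uparrow\infty$, to a limit $\ell_1\in(0,\infty)$. (ii) There exists $r_2\in(0,1)$ such that $2^{n(2r_2-2)}s_n^2$ converges to a limit $\ell_2\in(0,\infty)$. (iii) There exists $r_3\in(0,1)$ such that $2^{n(2r_3-2)}(s_{n+1}^2-s_n^2)$ converges to a limit $\ell_3\in(0,\infty)$. In this case, $r:=r_1=r_2=r_3$ and $\ell_1=\ell_2=(2^{2-2r}-1)^{-1}\ell_3$. (b) The equivalent conditions in part (a) imply that $\lim_n\widehat R^*_n(x)=r$, where $$\widehat R_n^*(x):=1-\frac1n\log_2\sqrt{\sum_{k=0}^{2^n-1}\theta_{n,k}^2}.$$ (c) If $\widehat R_n^*(x)$ converges to the finite limit $r$, then also $\lim_n\widehat R_n(x)=r$.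
   Context: For $p>0$ and $n\in\mathbb N$, $\langle x\rangle_n^{(p)}:=\sum_{k=0}^{2^n-1}|x((k+1)2^{-n})-x(k2^{-n})|^p$. The Faber--Schauder coefficients of $x$ are $\theta_{m,k}:=2^{m/2}\big(2x(\tfrac{2k+1}{2^{m+1}})-x(\tfrac{k}{2^m})-x(\tfrac{k+1}{2^m})\big)$ for $m\in\mathbb N_0$, $k=0,\dots,2^m-1$. For $n\in\mathbb N$, $s_n:=\sqrt{\sum_{m=0}^{n-1}\sum_{k=0}^{2^m-1}\theta_{m,k}^2}$ and $\widehat R_n(x):=1-\frac1n\log_2 s_n$.
   Formalization: Part (c) is proved for limits r ≤ 1 only; for r > 1 it always fails (then s_n has a finite positive limit and the estimator tends to 1), e.g. x(t)=t² has starred estimator tending to 2 but unstarred one tending to 1. *)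

(* Defs.v *)
From HB Require Import structures.
From mathcomp Require Import all_boot all_order all_algebra.
From mathcomp Require Import all_classical all_reals all_analysis.

Set Implicit Arguments.
Unset Strict Implicit.
Unset Printing Implicit Defensive.

Import Order.TTheory GRing.Theory Num.Theory numFieldNormedType.Exports.

Local Open Scope classical_set_scope.
Local Open Scope ring_scope.

(* A path in C[0,1] is a function x : R -> R with {within `[0, 1], continuous x};
   every definition below evaluates x at points of [0, 1] only. *)

Definition nonconstant01 (R : realType) (x : R -> R) : Prop :=
  exists s t : R, [/\ s \in `[0, 1], t \in `[0, 1] & x s != x t].

Definition dyadic_variation (R : realType) (x : R -> R) (p : R) (n : nat) : R :=
  \sum_(k < 2 ^ n)
    `|x (k.+1%:R / 2 ^+ n) - x (k%:R / 2 ^+ n)| `^ p.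

Definition theta (R : realType) (x : R -> R) (m k : nat) : R :=
  2 `^ (m%:R / 2) *
  (2 * x ((2 * k + 1)%:R / 2 ^+ m.+1)
   - x (k%:R / 2 ^+ m) - x (k.+1%:R / 2 ^+ m)).

Definition s_ (R : realType) (x : R -> R) (n : nat) : R :=
  Num.sqrt (\sum_(m < n) \sum_(k < 2 ^ m) theta x m k ^+ 2).

(* Extended-real valued, so that log2 0 = -oo; in particular the estimators
   below equal +oo at every n >= 1 at which their argument vanishes. *)
Definition log2 (R : realType) (a : R) : \bar R :=
  (lne a%:E * (ln 2)^-1%:E)%E.

Definition Rhat (R : realType) (x : R -> R) (n : nat) : \bar R :=
  (1 - n%:R^-1%:E * log2 (s_ x n))%E.

Definition Rhat_star (R : realType) (x : R -> R) (n : nat) : \bar R :=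
  (1 - n%:R^-1%:E * log2 (Num.sqrt (\sum_(k < 2 ^ n) theta x n k ^+ 2)))%E.

Definition qv_scaling (R : realType) (x : R -> R) (r l : R) : Prop :=
  [/\ 0 < r < 1, 0 < l &
      2 `^ (n%:R * (2 * r - 1)) * dyadic_variation x 2 n @[n --> \oo] --> l].

Definition s_scaling (R : realType) (x : R -> R) (r l : R) : Prop :=
  [/\ 0 < r < 1, 0 < l &
      2 `^ (n%:R * (2 * r - 2)) * s_ x n ^+ 2 @[n --> \oo] --> l].

Definition s_incr_scaling (R : realType) (x : R -> R) (r l : R) : Prop :=
  [/\ 0 < r < 1, 0 < l &
      2 `^ (n%:R * (2 * r - 2)) * (s_ x n.+1 ^+ 2 - s_ x n ^+ 2)
        @[n --> \oo] --> l].

(* Main.v *)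
Require Import Defs.
From HB Require Import structures.
From mathcomp Require Import all_boot all_order all_algebra.
From mathcomp Require Import all_classical all_reals all_analysis.
From mathcomp Require Import ring lra.

Set Implicit Arguments.
Unset Strict Implicit.
Unset Printing Implicit Defensive.

Import Order.TTheory GRing.Theory Num.Theory numFieldNormedType.Exports.

Local Open Scope classical_set_scope.
Local Open Scope ring_scope.

(** Writing u and v for the two increments of x over the halves of a dyadic
interval of generation m, the Faber--Schauder coefficient on that interval is
2^(m/2) (u - v), and the parallelogram law u^2 + v^2 = ((u+v)^2 + (u-v)^2)/2
says how the quadratic variation changes under bisection. It telescopes to
2^n <x>_n = (x(1) - x(0))^2 + s_n^2 ([quadratic_variation_energy]). For r < 1
the weight 2^(n(2r-2)) = q^n is geometric with q < 1, so it kills the constant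
term: the scaling laws of <x>_n and of s_n^2 coincide, with the same r and the
same limit.

The increment s_(n+1)^2 - s_n^2 is the energy of generation n. If A_n is any
sequence, b_n = q^n A_n and c_n = q^n (A_(n+1) - A_n), then
b_(n+1) = q (b_n + c_n): convergence of b gives that of c directly
([cvg_weighted_increment]), and since q < 1 the recursion is a contraction, so
convergence of c gives that of b ([cvg_weighted_sum]). This makes the scaling
laws of s_n^2 and of its increments equivalent, with the factor q^-1 - 1
between the two limits.

An estimator 1 - log2(sqrt(u_n))/n tends to r exactly when
u_n grows like 2^(n(2-2r)) up to subexponential factors ([estimator_cvgP]).
A sequence whose q^n multiple has a positive finite limit has this growth
([exponential_rate_cvg]), so each scaling law makes Rhat_star converge to its
exponent; as limits are unique, the exponents of the three laws agree.
Nonnegative increments and their partial sums have the same growth exponent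
provided that this exponent, 2 - 2r, is nonnegative ([exponential_rate_sum]),
which transfers the limit from Rhat_star to Rhat when r <= 1. *)

(** * Dyadic energies and quadratic variation *)

Definition level_energy (R : realType) (x : R -> R) (m : nat) : R :=
  \sum_(k < 2 ^ m) theta x m k ^+ 2.

Lemma level_energy_ge0 (R : realType) (x : R -> R) (m : nat) :
  0 <= level_energy x m.
Proof. by apply: sumr_ge0 => k _; exact: sqr_ge0. Qed.

Lemma s_sqrE (R : realType) (x : R -> R) (n : nat) :
  s_ x n ^+ 2 = \sum_(m < n) level_energy x m.
Proof.
rewrite sqr_sqrtr //; apply: sumr_ge0 => m _; exact: level_energy_ge0.
Qed.

Lemma s_sqrS (R : realType) (x : R -> R) (n : nat) :
  s_ x n.+1 ^+ 2 = s_ x n ^+ 2 + level_energy x n.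
Proof. by rewrite !s_sqrE big_ord_recr. Qed.

Lemma sum_ord_double (V : zmodType) (F : nat -> V) (N : nat) :
  \sum_(k < 2 * N) F k = \sum_(k < N) (F (2 * k)%N + F (2 * k + 1)%N).
Proof.
elim: N => [|N IHN]; first by rewrite !big_ord0.
by rewrite mulnS !big_ord_recr /= IHN addn1 addrA.
Qed.

Lemma dyadic_variation2 (R : realType) (x : R -> R) (n : nat) :
  dyadic_variation x 2 n =
  \sum_(k < 2 ^ n) (x (k.+1%:R / 2 ^+ n) - x (k%:R / 2 ^+ n)) ^+ 2.
Proof.
apply: eq_bigr => k _.
by rewrite (powR_mulrn 2 (normr_ge0 _)) real_normK ?num_real.
Qed.

Lemma theta_sqr (R : realType) (x : R -> R) (m k : nat) :
  theta x m k ^+ 2 = 2 ^+ m *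
    (2 * x ((2 * k + 1)%:R / 2 ^+ m.+1)
     - x (k%:R / 2 ^+ m) - x (k.+1%:R / 2 ^+ m)) ^+ 2.
Proof.
rewrite /theta exprMn; congr (_ * _).
rewrite -(powR_mulrn 2 (powR_ge0 _ _)) -powRrM divfK ?pnatr_eq0 //.
by rewrite powR_mulrn.
Qed.

(** The parallelogram law for the two half-increments of each dyadic interval:
their sum is the coarse increment and their difference the coefficient. *)
Lemma dyadic_variationS (R : realType) (x : R -> R) (n : nat) :
  2 ^+ n.+1 * dyadic_variation x 2 n.+1 =
  2 ^+ n * dyadic_variation x 2 n + level_energy x n.
Proof.
rewrite !dyadic_variation2 /level_energy.
rewrite -(big_mkord xpredT (fun k =>
  (x (k.+1%:R / 2 ^+ n.+1) - x (k%:R / 2 ^+ n.+1)) ^+ 2)).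
rewrite expnS big_mkord (sum_ord_double (fun k =>
  (x (k.+1%:R / 2 ^+ n.+1) - x (k%:R / 2 ^+ n.+1)) ^+ 2)).
rewrite !mulr_sumr -big_split /=; apply: eq_bigr => k _.
have coarse (j : nat) : (2 * j)%:R / 2 ^+ n.+1 = j%:R / 2 ^+ n :> R.
  by rewrite exprS natrM -mulf_div divff ?mul1r // pnatr_eq0.
rewrite theta_sqr !addn1 -[(2 * k).+2](mulnS 2 k) !coarse exprS.
by ring.
Qed.

Lemma quadratic_variation_energy (R : realType) (x : R -> R) (n : nat) :
  2 ^+ n * dyadic_variation x 2 n = dyadic_variation x 2 0 + s_ x n ^+ 2.
Proof.
elim: n => [|n IHn]; first by rewrite expr0 mul1r s_sqrE big_ord0 addr0.
by rewrite dyadic_variationS IHn s_sqrS addrA.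
Qed.

(** * Geometrically weighted partial sums *)

(** Once the perturbation d is below (1 - q) delta, the bound
|e_n| <= q^k |e_N| + delta propagates, because q (2 - q) <= 1. *)
Lemma contraction_cvg0 (R : realType) (q : R) (e d : nat -> R) :
  0 <= q < 1 -> (forall n, e n.+1 = q * (e n + d n)) ->
  d n @[n --> \oo] --> 0 -> e n @[n --> \oo] --> 0.
Proof.
move=> /andP[q0 q1] eS /cvgrPdist_le d0; apply/cvgrPdist_le => eps eps0.
have [|N _ dN] := d0 ((1 - q) * (eps / 2)); first by rewrite mulr_gt0 //; lra.
have bound k : `|e (k + N)%N| <= geometric `|e N| q k + eps / 2.
  elim: k => [|k IHk]; first by rewrite /geometric /= expr0; lra.
  rewrite addSn eS normrM (ger0_norm q0).
  have := dN (k + N)%N (leq_addl _ _); rewrite sub0r normrN => dk.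
  have step : `|e (k + N)%N + d (k + N)%N| <=
      geometric `|e N| q k + eps / 2 + (1 - q) * (eps / 2).
    exact: le_trans (ler_normD _ _) (lerD IHk dk).
  apply: le_trans (ler_wpM2l q0 step) _; rewrite /geometric /= exprS.
  have := mulr_ge0 (sqr_ge0 (1 - q)) (ltW eps0); nra.
have /cvgrPdist_le/(_ (eps / 2)) geo0 : geometric `|e N| q k @[k --> \oo] --> 0.
  by apply: cvg_geometric; rewrite ger0_norm.
have [|M _ geoM] := geo0; first lra.
exists (M + N)%N => // n /= MNn.
have Nn : (N <= n)%N by apply: leq_trans MNn; exact: leq_addl.
rewrite sub0r normrN -(subnK Nn); apply: le_trans (bound _) _.
have := geoM (n - N)%N; rewrite /= leq_subRL // addnC => /(_ MNn).
by rewrite sub0r normrN => /(le_trans (ler_norm _)); lra.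
Qed.

(** A geometrically weighted Stolz--Cesaro theorem: the distance of q^n A_n to
its limit, the fixed point of b = q (b + l), follows a perturbed
contraction. *)
Lemma cvg_weighted_sum (R : realType) (q l : R) (A : nat -> R) :
  0 <= q < 1 -> q ^+ n * (A n.+1 - A n) @[n --> \oo] --> l ->
  q ^+ n * A n @[n --> \oo] --> q * l / (1 - q).
Proof.
move=> q01 cl; have q1 : 1 - q != 0 by case/andP: q01 => _; lra.
apply/subr_cvg0; apply: (@contraction_cvg0 _ q _
  (fun n => q ^+ n * (A n.+1 - A n) - l)) => //; last exact/subr_cvg0.
by move=> n; rewrite exprS; field.
Qed.

Lemma cvg_weighted_increment (R : realType) (q l : R) (A : nat -> R) :
  q != 0 -> q ^+ n * A n @[n --> \oo] --> l ->
  q ^+ n * (A n.+1 - A n) @[n --> \oo] --> (q^-1 - 1) * l.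
Proof.
move=> q0 bl.
rewrite (_ : (fun n => _) =
  (fun n => q^-1 * (q ^+ n.+1 * A n.+1) - q ^+ n * A n)); last first.
  by apply/funext => n; rewrite exprS; field.
rewrite mulrBl mul1r; apply: cvgB => //; apply: cvgMl_tmp.
by move: bl; rewrite -(cvg_shiftS (fun n => q ^+ n * A n)).
Qed.

(** * Exponential growth rates *)

Definition log2r (R : realType) (y : R) : R := ln y / ln 2.

Lemma ln2_gt0 (R : realType) : 0 < ln 2 :> R.
Proof. by rewrite ln_gt0 // ltr1n. Qed.

Lemma pow2_gt0 (R : realType) (y : R) : 0 < 2 `^ y.
Proof. by rewrite powR_gt0. Qed.

Lemma pow2D (R : realType) (y z : R) : 2 `^ (y + z) = 2 `^ y * 2 `^ z.
Proof. by rewrite powRD // pnatr_eq0 implybT. Qed.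

Lemma ler_pow2 (R : realType) (y z : R) : (2 `^ y <= 2 `^ z) = (y <= z).
Proof.
rewrite -[LHS]ler_ln ?posrE ?pow2_gt0 //=.
by rewrite !ln_powR ler_pM2r // ln2_gt0.
Qed.

Lemma pow2_lt1 (R : realType) (y : R) : y < 0 -> 2 `^ y < 1.
Proof. by move=> y0; rewrite -[ltRHS](powRr0 2) ltNge ler_pow2 -ltNge. Qed.

Lemma pow2_gt1 (R : realType) (y : R) : 0 < y -> 1 < 2 `^ y.
Proof. by move=> y0; rewrite -[ltLHS](powRr0 2) ltNge ler_pow2 -ltNge. Qed.

Lemma pow2_log2r (R : realType) (y : R) : 0 < y -> 2 `^ (log2r y) = y.
Proof.
move=> y0; apply: ln_inj; rewrite ?posrE ?pow2_gt0 // ln_powR divfK //.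
by rewrite gt_eqF // ln2_gt0.
Qed.

Lemma pow2_natM (R : realType) (n : nat) (a : R) :
  2 `^ (n%:R * a) = (2 `^ a) ^+ n.
Proof. by rewrite mulrC powRrM powR_mulrn // powR_ge0. Qed.

Lemma near_le_pow2 (R : realType) (K e : R) :
  0 < e -> \forall n \near \oo, K <= 2 `^ (n%:R * e).
Proof.
move=> e0; have K1 : 0 < `|K| + 1 by rewrite ltr_wpDl.
near=> n; apply: (@le_trans _ _ (`|K| + 1)).
  by rewrite (le_trans (ler_norm K)) // lerDl.
rewrite -{1}(pow2_log2r K1) ler_pow2 -ler_pdivrMr //.
near: n; exact: nbhs_infty_ger.
Unshelve. all: by end_near. Qed.

(** Two-sided form of (log2 u_n) / n --> a that avoids logarithms and forces
u_n to be eventually positive. *)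
Definition exponential_rate (R : realType) (u : nat -> R) (a : R) : Prop :=
  forall e, 0 < e ->
    \forall n \near \oo, 2 `^ (n%:R * (a - e)) <= u n <= 2 `^ (n%:R * (a + e)).

Lemma exponential_rate_cvg (R : realType) (u : nat -> R) (a l : R) :
  0 < l -> 2 `^ (n%:R * - a) * u n @[n --> \oo] --> l -> exponential_rate u a.
Proof.
move=> l0 cl e e0.
near=> n.
have lo : l / 2 < 2 `^ (n%:R * - a) * u n.
  near: n; apply: (cvgr_gt _ cl); lra.
have hi : 2 `^ (n%:R * - a) * u n < 2 * l.
  near: n; apply: (cvgr_lt _ cl); lra.
have Kl : 2 / l <= 2 `^ (n%:R * e) by near: n; exact: near_le_pow2.
have Ku : 2 * l <= 2 `^ (n%:R * e) by near: n; exact: near_le_pow2.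
have uE : u n = 2 `^ (n%:R * a) * (2 `^ (n%:R * - a) * u n).
  by rewrite mulrA -pow2D -mulrDr subrr mulr0 powRr0 mul1r.
rewrite mulrBr mulrDr -mulrN !pow2D {1 2}uE !ler_pM2l ?pow2_gt0 //.
apply/andP; split; last exact: le_trans (ltW hi) Ku.
apply: le_trans (ltW lo); rewrite mulrN powRN.
by rewrite -[l / 2]invrK invf_div lef_pV2 ?posrE ?pow2_gt0 // divr_gt0.
Unshelve. all: by end_near. Qed.

(** The last term bounds the sum from below. For the upper bound, the terms
weighted by 2^(-n(a+e)) tend to 0, hence so do the weighted sums; this needs a
weight ratio smaller than 1, which is where a >= 0 enters: for a < 0 the sums
may well converge to a positive number. *)
Lemma exponential_rate_sum (R : realType) (A h : nat -> R) (a : R) :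
  (forall n, A n.+1 = A n + h n) -> (forall n, 0 <= A n) -> 0 <= a ->
  exponential_rate h a -> exponential_rate A a.
Proof.
move=> AS A0 a0 hrate e e0.
have upper : \forall n \near \oo, A n <= 2 `^ (n%:R * (a + e)).
  have e2 : 0 < e / 2 by lra.
  have q01 : 0 <= 2 `^ (- (a + e)) < 1.
    by rewrite powR_ge0 /= pow2_lt1 // oppr_lt0; lra.
  (* The rate of h at precision e / 2 leaves a factor 2^(-n e/2) to spare. *)
  have incr0 : (2 `^ (- (a + e))) ^+ n * (A n.+1 - A n) @[n --> \oo] --> 0.
    apply/cvgrPdist_le => eps eps0; near=> n.
    rewrite sub0r normrN AS (addrC (A n)) addrK.
    have /andP[h0 hn] :
        2 `^ (n%:R * (a - e / 2)) <= h n <= 2 `^ (n%:R * (a + e / 2)).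
      by near: n; exact: hrate.
    have hge0 := le_trans (powR_ge0 _ _) h0.
    rewrite ger0_norm ?mulr_ge0 ?exprn_ge0 ?powR_ge0 // -pow2_natM.
    have Kn : eps^-1 <= 2 `^ (n%:R * (e / 2)) by near: n; exact: near_le_pow2.
    apply: le_trans (ler_wpM2l (powR_ge0 _ _) hn) _.
    rewrite -pow2D -mulrDr (_ : _ + _ = - (e / 2)); last by field.
    by rewrite mulrN powRN -[eps]invrK lef_pV2 ?posrE ?pow2_gt0 ?invr_gt0.
  have := cvg_weighted_sum q01 incr0; rewrite mulr0 mul0r => b0.
  near=> n.
  have : (2 `^ (- (a + e))) ^+ n * A n <= 1.
    near: n; exact: (cvgr_le _ b0).
  by rewrite -pow2_natM mulrN powRN mulrC ler_pdivrMr ?pow2_gt0 // mul1r.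
have lower : \forall n \near \oo, 2 `^ (n%:R * (a - e)) <= A n.
  have e2 : 0 < e / 2 by lra.
  (* A_(n+1) >= h_n: the rate of h at precision e / 2 absorbs the index shift
     once n is large. *)
  apply: near_inftyS; near=> n.
  have /andP[hn _] :
      2 `^ (n%:R * (a - e / 2)) <= h n <= 2 `^ (n%:R * (a + e / 2)).
    by near: n; exact: hrate.
  rewrite AS; apply: le_trans (le_trans hn _); last by rewrite lerDr.
  rewrite ler_pow2 -natr1.
  have : (a - e) / (e / 2) <= n%:R by near: n; exact: nbhs_infty_ger.
  rewrite ler_pdivrMr //; lra.
by near=> n; apply/andP; split; near: n.
Unshelve. all: by end_near. Qed.

(** * Roughness estimators *)

Lemma estimatorE (R : realType) (u : R) (n : nat) :
  0 < u -> (1 - n%:R^-1%:E * log2 (Num.sqrt u))%E =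
           (1 - n%:R^-1 * (log2r u / 2))%:E.
Proof.
move=> u0; have su0 : 0 < Num.sqrt u by rewrite sqrtr_gt0.
rewrite /log2 lne_EFin // -!EFinM -EFinB; congr (1 - _ * _)%:E.
rewrite /log2r -[in RHS](sqr_sqrtr (ltW u0)) lnXn // mulr2n.
by field; rewrite gt_eqF // ln2_gt0.
Qed.

Lemma estimator0 (R : realType) (n : nat) :
  (0 < n)%N -> (1 - n%:R^-1%:E * log2 (Num.sqrt 0))%E = +oo%E :> \bar R.
Proof.
move=> n0; rewrite sqrtr0 /log2 le0_lneNy //.
rewrite gt0_mulNye ?lte_fin ?invr_gt0 ?ln2_gt0 //.
by rewrite gt0_muleNy ?lte_fin ?invr_gt0 ?ltr0n.
Qed.

(** Convergence to a finite limit excludes u_n = 0 for large n, where the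
estimator is infinite; where u_n > 0 the estimator is within e of r iff log2 u_n
is within 2 n e of n (2 - 2r). *)
Lemma estimator_cvgP (R : realType) (u : nat -> R) (r : R) :
  (forall n, 0 <= u n) ->
  (1 - n%:R^-1%:E * log2 (Num.sqrt (u n)))%E @[n --> \oo] --> r%:E <->
  exponential_rate u (2 - 2 * r).
Proof.
move=> u0.
have bounds (n : nat) (e : R) : (0 < n)%N -> 0 < u n ->
    (2 `^ (n%:R * (2 - 2 * r - 2 * e)) <= u n <= 2 `^ (n%:R * (2 - 2 * r + 2 * e)))
    = (`|r - (1 - n%:R^-1 * (log2r (u n) / 2))| <= e).
  move=> n0 un0; rewrite -{1 2}(pow2_log2r un0) !ler_pow2 ler_norml.
  have n0' : 0 < n%:R :> R by rewrite ltr0n.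
  set X := n%:R^-1 * _; have -> : log2r (u n) = n%:R * (2 * X).
    by rewrite /X; field; rewrite gt_eqF.
  by rewrite !ler_pM2l //; apply/andP/andP => -[]; split; lra.
split=> [/fine_cvgP[fin /cvgrPdist_le cv] e e0 | rate].
  near=> n.
  have n0 : (0 < n)%N by near: n; exact: nbhs_infty_gt.
  have un0 : 0 < u n.
    rewrite lt_neqAle u0 andbT eq_sym; apply/eqP => un.
    have : (1 - n%:R^-1%:E * log2 (Num.sqrt (u n)))%E \is a fin_num by near: n.
    by rewrite un estimator0.
  have : `|r - fine (1 - n%:R^-1%:E * log2 (Num.sqrt (u n)))%E| <= e / 2.
    near: n; apply: cv; lra.
  by rewrite estimatorE //= -bounds // mulrCA divff ?mulr1 // pnatr_eq0.
have upos : \forall n \near \oo, 0 < u n.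
  near=> n; apply: (@lt_le_trans _ _ (2 `^ (n%:R * (2 - 2 * r - 1)))).
    exact: pow2_gt0.
  suff /andP[] : 2 `^ (n%:R * (2 - 2 * r - 1)) <= u n
                 <= 2 `^ (n%:R * (2 - 2 * r + 1)) by [].
  by near: n; exact: rate.
apply/fine_cvgP; split.
  by near=> n; rewrite estimatorE //; near: n.
apply/cvgrPdist_le => e e0; near=> n.
have un0 : 0 < u n by near: n.
rewrite /= estimatorE //= -bounds //; last by near: n; exact: nbhs_infty_gt.
near: n; apply: rate; lra.
Unshelve. all: by end_near. Qed.

(** * The scaling laws *)

Lemma s_scalingE (R : realType) (x : R -> R) (r l : R) :
  s_scaling x r l <->
  [/\ 0 < r < 1, 0 < l &
      (2 `^ (2 * r - 2)) ^+ n * s_ x n ^+ 2 @[n --> \oo] --> l].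
Proof. by rewrite /s_scaling; under eq_fun do rewrite pow2_natM. Qed.

Lemma s_incr_scalingE (R : realType) (x : R -> R) (r l : R) :
  s_incr_scaling x r l <->
  [/\ 0 < r < 1, 0 < l &
      (2 `^ (2 * r - 2)) ^+ n * (s_ x n.+1 ^+ 2 - s_ x n ^+ 2)
        @[n --> \oo] --> l].
Proof. by rewrite /s_incr_scaling; under eq_fun do rewrite pow2_natM. Qed.

(** The two weighted sequences differ by (x(1) - x(0))^2 times a geometric
sequence of ratio 2^(2r-2) < 1. *)
Lemma qv_scaling_iff (R : realType) (x : R -> R) (r l : R) :
  qv_scaling x r l <-> s_scaling x r l.
Proof.
rewrite s_scalingE; set q := 2 `^ (2 * r - 2).
have qvE : (fun n => 2 `^ (n%:R * (2 * r - 1)) * dyadic_variation x 2 n) =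
    (fun n => q ^+ n * dyadic_variation x 2 0 + q ^+ n * s_ x n ^+ 2).
  apply/funext => n; rewrite -mulrDr -quadratic_variation_energy mulrA.
  congr (_ * _); rewrite -(powR_mulrn n (ler0n _ 2)) -pow2_natM -pow2D.
  by congr (_ `^ _); ring.
have const0 : 0 < r < 1 -> q ^+ n * dyadic_variation x 2 0 @[n --> \oo] --> 0.
  move=> /andP[_ r1]; have q1 : `|q| < 1.
    by rewrite ger0_norm ?powR_ge0 // pow2_lt1 //; lra.
  rewrite -(mul0r (dyadic_variation x 2 0)).
  by apply: cvgMr_tmp; exact: cvg_expr.
rewrite /qv_scaling qvE; split=> -[r01 l0 cl]; split=> //.
  rewrite -[l]subr0.
  have -> : (fun n => q ^+ n * s_ x n ^+ 2) =
      (fun n => q ^+ n * dyadic_variation x 2 0 + q ^+ n * s_ x n ^+ 2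
                - q ^+ n * dyadic_variation x 2 0).
    by apply/funext => n; rewrite addrAC subrr add0r.
  by apply: cvgB => //; exact: const0.
by rewrite -[l]add0r; apply: cvgD => //; exact: const0.
Qed.

Lemma s_scaling_incr (R : realType) (x : R -> R) (r l : R) :
  s_scaling x r l -> s_incr_scaling x r ((2 `^ (2 - 2 * r) - 1) * l).
Proof.
rewrite s_scalingE s_incr_scalingE => -[r01 l0 cl]; split=> //.
  rewrite mulr_gt0 // subr_gt0 pow2_gt1 //; case/andP: r01 => _; lra.
rewrite -[2 - 2 * r]opprB powRN; apply: (cvg_weighted_increment _ cl).
by rewrite gt_eqF // pow2_gt0.
Qed.

Lemma s_incr_scaling_s (R : realType) (x : R -> R) (r l : R) :
  s_incr_scaling x r l -> s_scaling x r ((2 `^ (2 - 2 * r) - 1)^-1 * l).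
Proof.
rewrite s_scalingE s_incr_scalingE => -[r01 l0 cl].
have w0 : 0 < 2 `^ (2 - 2 * r) - 1.
  by rewrite subr_gt0 pow2_gt1 //; case/andP: r01 => _; lra.
split=> //; first by rewrite mulr_gt0 ?invr_gt0.
have q1 : 2 `^ (2 * r - 2) < 1.
  by rewrite pow2_lt1 //; case/andP: r01 => _; lra.
have := cvg_weighted_sum _ cl; rewrite powR_ge0 q1 => /(_ isT).
congr (_ --> _); move: w0; rewrite -[2 - 2 * r]opprB powRN.
set q := 2 `^ _ in q1 * => w0; have q0 : 0 < q by exact: pow2_gt0.
by field; apply/andP; split; lra.
Qed.

Lemma s_incr_scaling_star (R : realType) (x : R -> R) (r l : R) :
  s_incr_scaling x r l -> Rhat_star x n @[n --> \oo] --> r%:E.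
Proof.
move=> -[_ l0 cl]; apply/estimator_cvgP; first exact: level_energy_ge0.
apply: (exponential_rate_cvg l0); rewrite opprB; move: cl.
by under eq_fun do rewrite s_sqrS (addrC (s_ x _ ^+ 2)) addrK.
Qed.

Lemma Rhat_star_cvg_Rhat (R : realType) (x : R -> R) (r : R) :
  r <= 1 -> Rhat_star x n @[n --> \oo] --> r%:E ->
  Rhat x n @[n --> \oo] --> r%:E.
Proof.
move=> r1 /estimator_cvgP rate.
have {}rate := rate (level_energy_ge0 x).
rewrite /Rhat /s_; apply/estimator_cvgP => [n|].
  by apply: sumr_ge0 => m _; exact: level_energy_ge0.
apply: (exponential_rate_sum _ _ _ rate) => [n|n|].
- by rewrite big_ord_recr.
- by apply: sumr_ge0 => m _; exact: level_energy_ge0.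
- lra.
Qed.

Theorem proposition4p1 (R : realType) (x : R -> R)
    (x_cont : {within `[0, 1], continuous x}) (x_nc : nonconstant01 x) :
  [/\ ((exists r1 l1 : R, qv_scaling x r1 l1) <->
       (exists r2 l2 : R, s_scaling x r2 l2)),
      ((exists r2 l2 : R, s_scaling x r2 l2) <->
       (exists r3 l3 : R, s_incr_scaling x r3 l3)) &
      (forall r1 l1 r2 l2 r3 l3 : R,
         qv_scaling x r1 l1 -> s_scaling x r2 l2 -> s_incr_scaling x r3 l3 ->
         [/\ r1 = r2, r2 = r3, l1 = l2 &
             l2 = (2 `^ (2 - 2 * r1) - 1)^-1 * l3])] /\
  (forall r l : R,
     qv_scaling x r l \/ s_scaling x r l \/ s_incr_scaling x r l ->
     Rhat_star x n @[n --> \oo] --> r%:E) /\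
  (* For r > 1 this last implication fails: x t = t ^+ 2 has
     Rhat_star x n --> 2 but Rhat x n --> 1. *)
  (forall r : R, r <= 1 ->
     Rhat_star x n @[n --> \oo] --> r%:E ->
     Rhat x n @[n --> \oo] --> r%:E).
Proof.
split; first split.
- by split=> -[r [l /qv_scaling_iff H]]; exists r, l.
- split=> -[r [l H]]; exists r; first by eexists; exact: s_scaling_incr H.
  by eexists; exact: s_incr_scaling_s H.
- move=> r1 l1 r2 l2 r3 l3 /qv_scaling_iff H1 H2 H3.
  (* Each scaling law makes the same estimator converge to its exponent, so
     the exponents agree; uniqueness of limits then compares the constants. *)
  have c1 := s_incr_scaling_star (s_scaling_incr H1).
  have c2 := s_incr_scaling_star (s_scaling_incr H2).
  have c3 := s_incr_scaling_star H3.
  have [r12] : r1%:E = r2%:E by exact: (cvg_unique (@ereal_hausdorff R) c1 c2).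
  have [r23] : r2%:E = r3%:E by exact: (cvg_unique (@ereal_hausdorff R) c2 c3).
  move: H1 (s_incr_scaling_s H3) H2 => [_ _ k1] [_ _ k3] [_ _ k2].
  rewrite -r23 -r12 in k3; rewrite -r12 in k2.
  split=> //; first exact: (cvg_unique (@norm_hausdorff R R) k1 k2).
  exact: (cvg_unique (@norm_hausdorff R R) k2 k3).
split; last by move=> r; exact: Rhat_star_cvg_Rhat.
move=> r l [/qv_scaling_iff H|[]H].
- exact: s_incr_scaling_star (s_scaling_incr H).
- exact: s_incr_scaling_star (s_scaling_incr H).
- exact: s_incr_scaling_star H.
Qed.
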